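(* Let $\mathbb{P}$ be a logic program and $A\in At(n)$ an atom. The following are equivalent (for a substitution $\theta$ with source $n$). 1. The saturated $\wedge\vee$-tree for $A$ in $\mathbb{P}$ has a synched refutation subtree with answer $\theta$. 2. For some object $m$ of $\mathbf{L}$ (i.e. some natural number $m$), the $m$-coinductive tree for $A\theta$ in $\mathbb{P}$ has a refutation subtree. 3. There is an SLD-refutation for $\{A\}$ in $\mathbb{P}$ with correct answer $\theta$.
   Context: Fix a signature $\Sigma$ and predicate symbols with arities. Substitutions: an arrow $\theta:n\to m$ ($n,m$ natural numbers) is an $n$-tuple $\langle t_1,\dots,t_n\rangle$ of $\Sigma$-terms with variables among $x_1,\dots,x_m$; $id_n=\langle x_1,\dots,x_n\rangle$; $\sigma\circ\theta$ is obtained by applying $\sigma$ to the terms of $\theta$. These form a category $\mathbf{L}=\mathbf{L}_\Sigma^{op}$ (the opposite Lawvere theory) whose objects are the natural numbers. $At(n)$ is the set of atoms $P(t_1,\dots,t_r)$ with variables among $x_1,\dots,x_n$ (an atom in $At(n)$ also belongs to $At(n')$ for $n'\ge n$, but its occurrences in $At(n)$ and $At(n')$, $n\neq n'$, are considered distinct); for a substitution $\theta$ with source $n$ and $A\in At(n)$, $A\theta$ is the result of substituting. A logic program is a finite set of clauses $H\leftarrow B_1,\dots,B_k$ ($k\ge0$); a clause $C$ has its variables among $x_1,\dots,x_{n_C}$, $n_C$ least. A unifier of $A'\in At(n')$ and the head $H$ of $C$ is a pair $\langle\sigma,\tau\rangle$, $\sigma:n'\to m'$, $\tau:n_C\to m'$,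 with $A'\sigma=H\tau$ (goal variables and clause variables are treated as disjoint); it is a term-matcher if $\sigma=id_{n'}$; it is most general if it is a pushout in $\mathbf{L}$ of the argument tuples of $A'$ and $H$ (viewed as arrows $r\to n'$ and $r\to n_C$, $r$ the arity of the common predicate). Saturated $\wedge\vee$-tree for $A\in At(n)$: the possibly infinite tree with alternating $\wedge$-nodes (labeled with atoms) and $\vee$-nodes (labeled with substitutions), root an $\wedge$-node labeled $A$, such that for every $\wedge$-node $s$ with label $A'\in At(n')$: for every clause $H\leftarrow B_1,\dots,B_k$ of $\mathbb{P}$ and every unifier $\langle\sigma,\tau\rangle$ of $A'$ and $H$, with $\sigma:n'\to m'$ and $B_1\tau,\dots,B_k\tau\in At(m')$, $s$ has exactly one child $t$ labeled $\sigma$, and conversely every child arises this way; and for each atom $B$ in $\{B_1,\dots,B_k\}\tau$, $t$ has exactly one child labeled $B\in At(m')$, and conversely. $m$-coinductive tree for an atom $A'\in At(m)$: defined in the same way, with root label $A'$, all $\wedge$-labels in $At(m)$, all $\vee$-nodes labeled $\bullet$, and only term-matchers $\langle id_m,\tau\rangle$ with $B_1\tau,\dots,B_k\tau\in At(m)$ used in place of all unifiers. (Speaking of the $m$-coinductive tree for $A\theta$ means regarding $A\theta$ as an element of $At(m)$, so its variables are among $x_1,\dots,x_m$.) A derivation subtree of such a tree $T$ is a subtree $T'$ (a set of nodes of $T$ forming a tree, with the child relation inherited from $T$) containing the root of $T$, such that each $\wedge$-node of $T'$ has just one of its children in $T'$ and each $\vee$-node of $T'$ has all its children in $T'$. It is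 a refutation subtree if it is finite and has only $\vee$-nodes as leaves. For a saturated $\wedge\vee$-tree, a derivation/refutation subtree is synched if moreover all its $\vee$-nodes at the same depth (root at depth $0$) are labeled with the same substitution; the answer of a synched refutation subtree is $\theta_{2k+1}\circ\dots\circ\theta_3\circ\theta_1$, where $\theta_i$ is the substitution labeling the $\vee$-nodes of depth $i$ and $2k+1$ is the maximal depth. SLD-resolution: starting from goal $G_0=\{A\}$ (atoms over $x_1,\dots,x_n$), at step $i$ one selects an atom $A_i$ in the current goal $G_i$ and a clause $H\leftarrow B_1,\dots,B_k$ whose head unifies with $A_i$, with most general unifier $\langle\sigma_i,\tau_i\rangle$, and puts $G_{i+1}=\{B_1,\dots,B_k\}\tau_i\cup(G_i\setminus\{A_i\})\sigma_i$. An SLD-refutation is such a computation reaching the empty goal in finitely many steps; its computed answer is the composite of the $\sigma_i$'s (first $\sigma_0$, then $\sigma_1$, and so on). A correct answer is a substitution of the form $\sigma\circ\tau$ with $\tau$ a computed answer and $\sigma$ a substitution. *)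

(* Defs.v *)
From mathcomp Require Import all_boot all_classical.

Set Implicit Arguments.
Unset Strict Implicit.
Unset Printing Implicit Defensive.

Local Open Scope classical_set_scope.

(* ** Terms, substitutions, atoms *)

Record language := Language {
  fsym : Type; farity : fsym -> nat;
  psym : Type; parity : psym -> nat }.

(* [term L 'I_m] is the type of terms with variables among x_1, ..., x_m
   (x_(i+1) being the ordinal i); [term L nat] allows all the variables. *)
Inductive term (L : language) (V : Type) : Type :=
| Var (x : V)
| App (f : fsym L) (args : 'I_(farity f) -> term L V).
Arguments Var {L V} x.
Arguments App {L V} f args.

Record atom (L : language) (V : Type) : Type :=
  Atom { apred : psym L; aargs : 'I_(parity apred) -> term L V }.
Arguments Atom {L V} apred aargs.
Arguments aargs {L V} _ i.

Definition At (L : language) (n : nat) := atom L 'I_n.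

Fixpoint tsubst (L : language) (V W : Type) (s : V -> term L W)
    (t : term L V) : term L W :=
  match t with
  | Var x => s x
  | App f args => App f (fun i => tsubst s (args i))
  end.

Definition asubst (L : language) (V W : Type) (s : V -> term L W)
    (A : atom L V) : atom L W :=
  Atom (apred A) (fun i => tsubst s (aargs A i)).

(* The arrows n -> m of the opposite Lawvere theory. *)
Definition arrow (L : language) (n m : nat) := 'I_n -> term L 'I_m.

Definition id_arrow (L : language) (n : nat) : arrow L n n := fun i => Var i.

(* [compose s t] is the composite "s o t": first t, then s. *)
Definition compose (L : language) (n m k : nat)
    (s : arrow L m k) (t : arrow L n m) : arrow L n k :=
  fun i => tsubst s (t i).

(* Forgetting the bound m on the variables.  [raw_arrow t = u] says that the
   n-tuple u is (the tuple of terms of) the arrow t : n -> m; the same tuple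
   underlies arrows with different targets.  Likewise, [raw_atom B = A] says
   that B is A regarded as an element of At(m). *)
Definition raw_var (L : language) (m : nat) (i : 'I_m) : term L nat :=
  Var (nat_of_ord i).

Definition raw_arrow (L : language) (n m : nat) (t : arrow L n m) :
    'I_n -> term L nat :=
  fun i => tsubst (@raw_var L m) (t i).

Definition raw_atom (L : language) (m : nat) (A : At L m) : atom L nat :=
  asubst (@raw_var L m) A.

Definition atom_vars_among (L : language) (m : nat) (A : atom L nat) : Prop :=
  exists B : At L m, raw_atom B = A.

(* ** Clauses and unifiers *)

Record clause (L : language) := Clause {
  cvars : nat;
  chead : At L cvars;
  csize : nat;
  cbody : 'I_csize -> At L cvars;
  cvars_least : forall m : nat,
    atom_vars_among m (raw_atom chead) ->
    (forall j, atom_vars_among m (raw_atom (cbody j))) ->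
    (cvars <= m)%N }.
Arguments cbody {L} _ j.

Definition unifier (L : language) (n : nat) (A : At L n) (C : clause L)
    (m : nat) (s : arrow L n m) (t : arrow L (cvars C) m) : Prop :=
  asubst s A = asubst t (chead C).

Definition is_pushout (L : language) (r n c m : nat)
    (a : arrow L r n) (h : arrow L r c)
    (s : arrow L n m) (t : arrow L c m) : Prop :=
  compose s a = compose t h /\
  forall (k : nat) (s' : arrow L n k) (t' : arrow L c k),
    compose s' a = compose t' h ->
    exists! u : arrow L m k, compose u s = s' /\ compose u t = t'.

Definition mgu (L : language) (n : nat) (A : At L n) (C : clause L)
    (m : nat) (s : arrow L n m) (t : arrow L (cvars C) m) : Prop :=
  exists (p : psym L) (a : arrow L (parity p) n)
         (h : arrow L (parity p) (cvars C)),
    [/\ A = Atom p a, chead C = Atom p h & is_pushout a h s t].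

Definition body_subst (L : language) (C : clause L) (m : nat)
    (t : arrow L (cvars C) m) : set (At L m) :=
  [set B | exists j, B = asubst t (cbody C j)].

(* ** And-or trees *)

(* An and-or tree is presented by a root label and a rule which, for every
   label [a] of an and-node, gives the family [branch a] of its or-children,
   their labels, and the set [succs c] of labels of the children of the
   or-child [c] (one child for each element of that set).  The nodes of the
   tree are the finite paths from the root. *)
Record rule := Rule {
  alabel : Type;
  olabel : Type;
  branch : alabel -> Type;
  blabel : forall a, branch a -> olabel;
  succs : forall a, branch a -> set alabel }.

Inductive branch_path (X : rule) (a0 : alabel X) : alabel X -> Type :=
| Root : branch_path a0 a0
| Extend a (p : branch_path a0 a) (c : branch a) b (hb : succs c b) :
    branch_path a0 b.

Fixpoint path_depth (X : rule) (a0 a : alabel X) (p : branch_path a0 a) :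
    nat :=
  match p with
  | Root => 0
  | Extend _ q _ _ _ => (path_depth q).+2
  end.

Record and_node (X : rule) (a0 : alabel X) :=
  AndNode { and_label : alabel X; and_path : branch_path a0 and_label }.

Record or_node (X : rule) (a0 : alabel X) :=
  OrNode { or_parent : and_node a0; or_branch : branch (and_label or_parent) }.

Definition root_node (X : rule) (a0 : alabel X) : and_node a0 := AndNode (Root a0).

Definition or_label (X : rule) (a0 : alabel X) (t : or_node a0) : olabel X :=
  blabel (or_branch t).

Definition or_depth (X : rule) (a0 : alabel X) (t : or_node a0) : nat :=
  (path_depth (and_path (or_parent t))).+1.

(* The and-node s is a child of the or-node t. *)
Definition and_child (X : rule) (a0 : alabel X)
    (t : or_node a0) (s : and_node a0) : Prop :=
  exists (b : alabel X) (hb : succs (or_branch t) b),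
    s = AndNode (Extend (and_path (or_parent t)) hb).

Record node_set (X : rule) (a0 : alabel X) :=
  NodeSet { ands : set (and_node a0); ors : set (or_node a0) }.

Definition is_subtree (X : rule) (a0 : alabel X) (S : node_set a0) : Prop :=
  [/\ ands S (root_node a0),
      forall t, ors S t -> ands S (or_parent t) &
      forall t s, and_child t s -> ands S s -> ors S t].

Definition derivation_subtree (X : rule) (a0 : alabel X) (S : node_set a0) :
    Prop :=
  [/\ is_subtree S,
      forall s, ands S s -> exists! t, or_parent t = s /\ ors S t &
      forall t s, ors S t -> and_child t s -> ands S s].

Definition refutation_subtree (X : rule) (a0 : alabel X) (S : node_set a0) :
    Prop :=
  [/\ derivation_subtree S,
      finite_set (ands S) /\ finite_set (ors S) &
      (* no and-node is a leaf *)
      forall s, ands S s -> exists t, or_parent t = s /\ ors S t].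

Definition synched (X : rule) (a0 : alabel X) (S : node_set a0) : Prop :=
  forall t t', ors S t -> ors S t' ->
    or_depth t = or_depth t' -> or_label t = or_label t'.

(* ** Saturated trees *)

Record packed_atom (L : language) :=
  PackAtom { pa_ctx : nat; pa_atom : At L pa_ctx }.

Record packed_arrow (L : language) :=
  PackArrow { pa_source : nat; pa_target : nat;
              pa_arrow : arrow L pa_source pa_target }.

Record sat_branch (L : language) (P : set (clause L)) (a : packed_atom L) :=
  SatBranch {
    sb_clause : clause L;
    sb_in : P sb_clause;
    sb_target : nat;
    sb_goal : arrow L (pa_ctx a) sb_target;
    sb_cl : arrow L (cvars sb_clause) sb_target;
    sb_unifier : unifier (pa_atom a) sb_goal sb_cl }.
Arguments sb_goal {L P a} _ i.
Arguments sb_cl {L P a} _ i.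

Definition saturated (L : language) (P : set (clause L)) : rule :=
  @Rule (packed_atom L) (packed_arrow L) (sat_branch P)
    (fun a c => PackArrow (sb_goal c))
    (fun a c => (@PackAtom L (sb_target c)) @` body_subst (sb_cl c)).

(* The root of the saturated tree for A. *)
Definition saturated_root (L : language) (P : set (clause L)) (n : nat)
    (A : At L n) : alabel (saturated P) := PackAtom A.

Definition label_at_depth (L : language) (P : set (clause L))
    (a0 : alabel (saturated P)) (S : node_set a0)
    (d n m : nat) (t : arrow L n m) : Prop :=
  exists o, [/\ ors S o, or_depth o = d & or_label o = PackArrow t].

(* [composite S d t]: d is odd and t = t_d o ... o t_3 o t_1, where t_i labels
   an or-node of S of depth i. *)
Inductive composite (L : language) (P : set (clause L))
    (a0 : alabel (saturated P)) (S : node_set a0) :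
    nat -> forall n m : nat, arrow L n m -> Prop :=
| composite_first n m (t : arrow L n m) :
    label_at_depth S 1 t -> composite S 1 t
| composite_next d n m k (t : arrow L n m) (s : arrow L m k) :
    composite S d t -> label_at_depth S d.+2 s ->
    composite S d.+2 (compose s t).

Definition answer (L : language) (P : set (clause L))
    (a0 : alabel (saturated P)) (S : node_set a0)
    (n m : nat) (t : arrow L n m) : Prop :=
  exists d, (forall o, ors S o -> (or_depth o <= d)%N) /\ composite S d t.

(* ** m-coinductive trees *)

Record coind_branch (L : language) (P : set (clause L)) (m : nat)
    (A : At L m) :=
  CoindBranch {
    cb_clause : clause L;
    cb_in : P cb_clause;
    cb_cl : arrow L (cvars cb_clause) m;
    cb_matcher : unifier A (@id_arrow L m) cb_cl }.
Arguments cb_cl {L P m A} _ i.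

Definition coinductive (L : language) (P : set (clause L)) (m : nat) : rule :=
  @Rule (At L m) unit (@coind_branch L P m)
    (fun A c => tt)
    (fun A c => body_subst (cb_cl c)).

(* The root of the m-coinductive tree for A. *)
Definition coinductive_root (L : language) (P : set (clause L)) (m : nat)
    (A : At L m) : alabel (coinductive P m) := A.

(* ** SLD-resolution *)

Definition sld_step (L : language) (P : set (clause L))
    (n : nat) (G : set (At L n)) (m : nat) (s : arrow L n m)
    (G' : set (At L m)) : Prop :=
  exists (A : At L n) (C : clause L) (t : arrow L (cvars C) m),
    [/\ G A, P C, mgu A s t &
        G' = body_subst t `|` asubst s @` (G `\ A)].

(* [sld_refutation P G t]: there is an SLD-refutation starting from G with
   computed answer t. *)
Inductive sld_refutation (L : language) (P : set (clause L)) :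
    forall (n : nat) (G : set (At L n)) (m : nat), arrow L n m -> Prop :=
| sld_empty n : sld_refutation P (set0 : set (At L n)) (@id_arrow L n)
| sld_next n m k (G : set (At L n)) (s : arrow L n m) (G' : set (At L m))
    (t : arrow L m k) :
    sld_step P G s G' -> sld_refutation P G' t ->
    sld_refutation P G (compose t s).

Definition correct_answer (L : language) (P : set (clause L))
    (n : nat) (A : At L n) (m : nat) (theta : arrow L n m) : Prop :=
  exists (k : nat) (t : arrow L n k) (s : arrow L k m),
    sld_refutation P [set A] t /\ theta = compose s t.

(* Main.v *)
(* All three conditions say that A theta has a well-founded derivation by term
   matching, over some set of variables.  For the saturated tree, substituting
   into each level of a synched refutation subtree the composite of the labels
   below it turns every unifier into a matcher; conversely a derivation of
   A theta is a synched subtree whose first label is theta and whose other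
   labels are identities.  For SLD-resolution, a derivation is lifted step by
   step: the matcher used on an instance of the selected atom is a unifier, so
   it factors through a most general one.  The pushouts needed here come from
   unification, by induction on the number of variables and on the terms. *)
Require Import Defs.
From mathcomp Require Import all_boot all_classical.

Set Implicit Arguments.
Unset Strict Implicit.
Unset Printing Implicit Defensive.

Local Open Scope classical_set_scope.

(** * Dependent injectivity and the algebra of substitutions *)

Lemma existT_inj (U : Type) (Q : U -> Type) (p : U) (x y : Q p) :
  existT Q p x = existT Q p y -> x = y.
Proof.
(* Symbols form arbitrary types, so proof irrelevance replaces decidable equality of the indices. *)
by move=> e; have := projT2_eq e; rewrite (Prop_irrelevance (projT1_eq e) erefl).
Qed.

Lemma App_inj (L : language) (V : Type) (f : Defs.fsym L)
    (a b : 'I_(farity f) -> term L V) : App f a = App f b -> a = b.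
Proof. by case=> e; exact: (existT_inj e). Qed.

Lemma PackAtom_inj (L : language) (n : nat) (A B : At L n) :
  PackAtom A = PackAtom B -> A = B.
Proof. by case=> e; exact: (existT_inj e). Qed.

Lemma PackArrow_inj (L : language) (n m : nat) (s t : arrow L n m) :
  PackArrow s = PackArrow t -> s = t.
Proof. by case=> e; exact: existT_inj (existT_inj e). Qed.

Lemma tsubst_comp (L : language) (U V W : Type) (s : V -> term L W)
    (t : U -> term L V) (x : term L U) :
  tsubst s (tsubst t x) = tsubst (fun i => tsubst s (t i)) x.
Proof. by elim: x => //= f a IH; congr App; apply/funext => i. Qed.

Lemma tsubst_var (L : language) (V : Type) (x : term L V) :
  tsubst (@Var L V) x = x.
Proof. by elim: x => //= f a IH; congr App; apply/funext => i. Qed.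

Lemma asubst_comp (L : language) (U V W : Type) (s : V -> term L W)
    (t : U -> term L V) (A : atom L U) :
  asubst s (asubst t A) = asubst (fun i => tsubst s (t i)) A.
Proof. by congr Atom; apply/funext => i /=; rewrite tsubst_comp. Qed.

Lemma asubst_var (L : language) (V : Type) (A : atom L V) :
  asubst (@Var L V) A = A.
Proof. by case: A => p a; congr Atom; apply/funext => i /=; rewrite tsubst_var. Qed.

Lemma compose_id (L : language) (n m : nat) (t : arrow L n m) :
  compose (@id_arrow L m) t = t.
Proof. by apply/funext => i; exact: tsubst_var. Qed.

Lemma compose_assoc (L : language) (n m k l : nat) (u : arrow L k l)
    (s : arrow L m k) (t : arrow L n m) :
  compose u (compose s t) = compose (compose u s) t.
Proof. by apply/funext => i; exact: tsubst_comp. Qed.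

Lemma asubst_compose (L : language) (n m k : nat) (s : arrow L m k)
    (t : arrow L n m) (A : At L n) :
  asubst (compose s t) A = asubst s (asubst t A).
Proof. by rewrite asubst_comp. Qed.

(** * Forgetting variable bounds *)

Lemma tsubst_raw_inj (L : language) (m : nat) : injective (tsubst (@raw_var L m)).
Proof.
elim=> [x|f a IH] [y|g b] //=; first by case=> /ord_inj ->.
case=> fg; subst g => e0; have e := existT_inj e0; congr App; apply/funext => i.
by apply: IH; exact: (congr1 (@^~ i) e).
Qed.

Lemma raw_atom_inj (L : language) (m : nat) : injective (@raw_atom L m).
Proof.
case=> p a [q b]; case=> pq; subst q => e0; have e := existT_inj e0; congr Atom.
by apply/funext => i; apply: tsubst_raw_inj; exact: (congr1 (@^~ i) e).
Qed.

Lemma raw_asubst (L : language) (n m : nat) (t : arrow L n m) (A : At L n) :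
  raw_atom (asubst t A) = asubst (raw_arrow t) A.
Proof. exact: asubst_comp. Qed.

(** Asking for every larger [k], not just one, lets finitely many bounds be merged into their
    maximum. *)
Lemma raw_family (L : language) (r : nat) (a : 'I_r -> term L nat) :
  (forall i, exists m, forall k, m <= k ->
     exists t : term L 'I_k, tsubst (@raw_var L k) t = a i) ->
  exists m, forall k, m <= k -> exists t : arrow L r k, raw_arrow t = a.
Proof.
move=> /choice[b Hb]; exists (\max_i b i) => k /bigmax_leqP bk.
have /choice[t Ht] : forall i, exists t : term L 'I_k, tsubst (@raw_var L k) t = a i.
  by move=> i; apply: Hb; exact: bk.
by exists t; apply/funext.
Qed.

Lemma raw_term_bound (L : language) (t : term L nat) :
  exists m, forall k, m <= k ->
    exists t' : term L 'I_k, tsubst (@raw_var L k) t' = t.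
Proof.
elim: t => [x|f a /raw_family[m Hm]].
  by exists x.+1 => k xk; exists (Var (Ordinal xk)).
by exists m => k /Hm[t <-]; exists (App f t).
Qed.

Lemma raw_arrow_bound (L : language) (n : nat) (theta : 'I_n -> term L nat) :
  exists m, forall k, m <= k -> exists t : arrow L n k, raw_arrow t = theta.
Proof. by apply: raw_family => i; exact: raw_term_bound. Qed.

(** Terms of [theta] at variables that do not occur in [A] may contain variables beyond [m]; [B] is
    therefore moved to a context large enough for all of [theta]. *)
Lemma raw_asubst_bound (L : language) (n m : nat) (theta : 'I_n -> term L nat)
    (A : At L n) (B : At L m) : raw_atom B = asubst theta A ->
  exists (k : nat) (t : arrow L n k) (w : arrow L m k),
    raw_arrow t = theta /\ asubst w B = asubst t A.
Proof.
have [l Hl] := raw_arrow_bound theta => BA.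
have [t tE] := Hl (maxn m l) (leq_maxr _ _).
pose w : arrow L m (maxn m l) := fun i => Var (widen_ord (leq_maxl m l) i).
exists (maxn m l), t, w; split=> //.
by apply: raw_atom_inj; rewrite !raw_asubst tE -BA.
Qed.

(** * Unification *)

Fixpoint depth (L : language) (V : Type) (t : term L V) : nat :=
  match t with
  | Var _ => 0
  | App f a => (\max_i depth (a i)).+1
  end.

Lemma depth_arg (L : language) (V : Type) (f : Defs.fsym L)
    (a : 'I_(farity f) -> term L V) (i : 'I_(farity f)) :
  depth (a i) < depth (App f a).
Proof. by rewrite /= ltnS (leq_bigmax (F := fun i => depth (a i))). Qed.

Definition epi (L : language) (n m : nat) (q : arrow L n m) : Prop :=
  forall (k : nat) (u v : arrow L m k), compose u q = compose v q -> u = v.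

(** For [sol := coequalizes a b] this is a coequalizer; [epi q] carries the uniqueness of
    factorizations. *)
Definition principal (L : language) (n m : nat)
    (sol : forall k, arrow L n k -> Prop) (q : arrow L n m) : Prop :=
  [/\ sol m q,
      forall k (s : arrow L n k), sol k s -> exists u, s = compose u q &
      epi q].

(* The strict decrease of the number of variables drives the induction. *)
Definition eliminates (L : language) (n : nat)
    (sol : forall k, arrow L n k -> Prop) : Prop :=
  exists (m : nat) (q : arrow L n m), m < n /\ principal sol q.

Definition unifies (L : language) (n : nat) (t1 t2 : term L 'I_n)
    (k : nat) (s : arrow L n k) : Prop := tsubst s t1 = tsubst s t2.

Definition coequalizes (L : language) (r n : nat) (a b : arrow L r n)
    (k : nat) (s : arrow L n k) : Prop := compose s a = compose s b.

Lemma principal_ext (L : language) (n m : nat)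
    (sol sol' : forall k, arrow L n k -> Prop) (q : arrow L n m) :
  (forall k s, sol k s <-> sol' k s) -> principal sol q -> principal sol' q.
Proof.
by move=> e [/e ? fac ?]; split=> // k s /e; exact: fac.
Qed.

Lemma eliminates_ext (L : language) (n : nat)
    (sol sol' : forall k, arrow L n k -> Prop) :
  (forall k s, sol k s <-> sol' k s) -> eliminates sol -> eliminates sol'.
Proof. by move=> e [m [q [mn /(principal_ext e) ?]]]; exists m, q. Qed.

(** Two conditions are solved in succession: [q'] solves what remains of the second one after [q],
    and stability keeps the first one true after [q']. *)
Lemma principal_compose (L : language) (n m k : nat)
    (sol1 sol2 : forall k, arrow L n k -> Prop)
    (q : arrow L n m) (q' : arrow L m k) :
  (forall k l (s : arrow L n k) (u : arrow L k l), sol1 k s -> sol1 l (compose u s)) ->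
  principal sol1 q -> principal (fun l u => sol2 l (compose u q)) q' ->
  principal (fun l s => sol1 l s /\ sol2 l s) (compose q' q).
Proof.
move=> stable [sq facq epiq] [sq' facq' epiq']; split.
- by split=> //; exact: stable.
- move=> l s [/facq[u ->] /facq'[v ->]]; exists v.
  by rewrite compose_assoc.
- move=> l u v; rewrite !compose_assoc => /epiq; exact: epiq'.
Qed.

(** The occurs check: if [x] is absent, [t] comes from a term in the other variables; if [x] sits
    strictly inside, every instance of [t] is deeper than that of [x]. *)
Lemma var_lift_or_deeper (L : language) (n : nat) (x : 'I_n) (t : term L 'I_n) :
  [\/ t = Var x,
      exists t' : term L 'I_n.-1, t = tsubst (fun j => Var (lift x j)) t' |
      forall k (s : arrow L n k), depth (s x) < depth (tsubst s t)].
Proof.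
elim: t => [y|f a IH].
  have [j ->|->] := unliftP x y; last by constructor 1.
  by constructor 2; exists (Var j).
have [/choice[b Hb]|/existsNP[i Hi]] := pselect (forall i,
    exists t' : term L 'I_n.-1, a i = tsubst (fun j => Var (lift x j)) t').
  by constructor 2; exists (App f b); congr App; apply/funext.
constructor 3 => k s; have := depth_arg (fun i => tsubst s (a i)) i.
apply: leq_ltn_trans; case: (IH i) => [->|//|/(_ k s)/ltnW] //.
Qed.

Lemma eliminate_var (L : language) (n : nat) (x : 'I_n) (t : term L 'I_n)
    (k : nat) (s : arrow L n k) :
  unifies (Var x) t s -> t = Var x \/ eliminates (unifies (Var x) t).
Proof.
rewrite /unifies /= => sx.
have [-> | [t' tE] | /(_ _ s)] := var_lift_or_deeper x t; first by left.
  right; exists n.-1.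
  (* [x] is replaced by [t'] and the other variables are renumbered. *)
  pose q : arrow L n n.-1 := fun y => if unlift x y is Some j then Var j else t'.
  have ql j : q (lift x j) = Var j by rewrite /q liftK.
  have qx : q x = t' by rewrite /q unlift_none.
  have cq l (u : arrow L n.-1 l) j : compose u q (lift x j) = u j.
    by rewrite /compose ql.
  exists q; split; first by case: (n) x {s sx t t' tE q ql qx cq} => [[]|].
  split.
  - rewrite /= qx tE tsubst_comp /=.
    by under [X in tsubst X _]funext do rewrite ql; rewrite tsubst_var.
  - move=> l r rx; exists (fun j => r (lift x j)); apply/funext => y.
    have [j ->|->] := unliftP x y; first by rewrite cq.
    by rewrite /compose qx rx tE tsubst_comp.
  - by move=> l u v uv; apply/funext => j; rewrite -!cq uv.
(* If [x] occurred strictly inside [t], the two equal instances under [s] would differ in depth. *)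
by rewrite -sx ltnn.
Qed.

Definition unifiable_eliminates (L : language) (n : nat)
    (t1 t2 : term L 'I_n) : Prop :=
  forall (k : nat) (s : arrow L n k),
    unifies t1 t2 s -> t1 = t2 \/ eliminates (unifies t1 t2).

(** Equations are solved one at a time. As long as they hold identically, the next one is handled by
    [single]; once a variable is eliminated, the remaining ones live in fewer variables and fall to
    [smaller]. *)
Lemma eliminate_family (L : language) (n r : nat) (a b : arrow L r n) :
  (forall i, unifiable_eliminates (a i) (b i)) ->
  (forall m (t1 t2 : term L 'I_m), m < n -> unifiable_eliminates t1 t2) ->
  forall (k : nat) (s : arrow L n k), coequalizes a b s ->
    a = b \/ eliminates (coequalizes a b).
Proof.
move=> single smaller k s sab.
have {}sab i : tsubst s (a i) = tsubst s (b i) by exact: (congr1 (@^~ i) sab).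
pose upto d l (s : arrow L n l) :=
  forall i : 'I_r, i < d -> tsubst s (a i) = tsubst s (b i).
suff H d : d <= r -> (forall i : 'I_r, i < d -> a i = b i) \/ eliminates (upto d).
  have [ab|] := H r (leqnn r); first by left; apply/funext => i; exact: ab.
  move=> E; right; apply: eliminates_ext E => l u; split=> [e|e i _].
    by apply/funext => i; exact: e.
  exact: (congr1 (@^~ i) e).
elim: d => [_|d IH dr]; first by left.
pose o := Ordinal dr.
have uptoS l (u : arrow L n l) :
    upto d l u /\ tsubst u (a o) = tsubst u (b o) <-> upto d.+1 l u.
  split=> [[ud uo] i|ud].
    by rewrite ltnS leq_eqVlt => /orP[/eqP id|/ud//]; rewrite (_ : i = o) //; exact: ord_inj.
  by split=> [i id|]; apply: ud => //; exact: ltnW.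
have [eqd|[m [q [mn pq]]]] := IH (ltnW dr).
  have [abo|E] := single o _ _ (sab o).
    left=> i; rewrite ltnS leq_eqVlt => /orP[/eqP id|/eqd//].
    by rewrite (_ : i = o) //; exact: ord_inj.
  right; apply: eliminates_ext E => l u; rewrite -uptoS; split=> [e|[]//].
  by split=> // i /eqd ->.
right; apply: eliminates_ext uptoS _.
have stable l l' (u : arrow L n l) (v : arrow L l l') :
    upto d l u -> upto d l' (compose v u).
  by move=> ud i /ud e; rewrite -!(tsubst_comp v u) e.
(* [s] solves the first [d] equations, so it factors through [q]; the factor [u] witnesses that the
   next equation stays solvable after [q]. *)
have [u su] : exists u, s = compose u q by case: pq => _ fac _; apply: fac => i _.
have [|e|[m' [q' [mm' pq']]]] := smaller _ (tsubst q (a o)) (tsubst q (b o)) mn _ u.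
- by rewrite /unifies !tsubst_comp; have := sab o; rewrite su.
- exists m, q; split=> //; case: pq => sq fac eq; split=> // l v [vd _].
  exact: fac.
- exists m', (compose q' q); split; first exact: ltn_trans mn.
  apply: principal_compose => //; apply: principal_ext pq' => l v.
  by rewrite /unifies !tsubst_comp.
Qed.

Lemma unification (L : language) (n : nat) (t1 t2 : term L 'I_n) :
  unifiable_eliminates t1 t2.
Proof.
have [N] := ubnP n; elim: N => // N IHN in n t1 t2 *; rewrite ltnS => nN.
elim: t1 t2 => [x|f a IHa] t2 k s st.
  by have [->|] := eliminate_var st; [left|right].
case: t2 st => [x|g b] st.
  have [->|E] := eliminate_var (esym st); [by left|right].
  by apply: eliminates_ext E => l u; split=> /esym.
(* A common instance forces equal head symbols, which leaves the argument tuples to be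
   coequalized. *)
move: (st); case=> fg _; subst g; move: st => /App_inj sab.
have [|m t1 t2 mn|->|E] := @eliminate_family _ _ _ a b _ _ _ s sab.
- by move=> i; exact: IHa.
- by apply: IHN; exact: leq_trans nN.
- by left.
- right; apply: eliminates_ext E => l u; split=> [e|/App_inj//].
  by congr App.
Qed.

(** * Coequalizers, pushouts and most general unifiers *)

Lemma coequalizer_exists (L : language) (r n k : nat) (a b : arrow L r n)
    (s : arrow L n k) : coequalizes a b s ->
  exists (m : nat) (q : arrow L n m), principal (coequalizes a b) q.
Proof.
move=> sab; have [i|m t1 t2 _|->|[m [q [_ pq]]]] := eliminate_family _ _ sab.
- exact: unification.
- exact: unification.
- exists n, (@id_arrow L n); split=> // l u _.
  by exists u.
- by exists m, q.
Qed.

(** The coproduct of [n] and [c] is [n + c], which keeps goal and clause variables apart;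
    coequalizing the two tuples there gives the pushout. *)
Lemma pushout_exists (L : language) (r n c k : nat)
    (a : arrow L r n) (h : arrow L r c)
    (s : arrow L n k) (t : arrow L c k) : compose s a = compose t h ->
  exists (m : nat) (s' : arrow L n m) (t' : arrow L c m), is_pushout a h s' t'.
Proof.
pose injl : arrow L n (n + c) := fun i => Var (lshift c i).
pose injr : arrow L c (n + c) := fun i => Var (rshift n i).
pose copair l (u : arrow L n l) (v : arrow L c l) : arrow L (n + c) l :=
  fun i => match fintype.split i with inl j => u j | inr j => v j end.
have copairl l u v : compose (copair l u v) injl = u.
  by apply/funext => i; rewrite /compose /= /copair (unsplitK (inl i)).
have copairr l u v : compose (copair l u v) injr = v.
  by apply/funext => i; rewrite /compose /= /copair (unsplitK (inr i)).
have copairE l (u : arrow L (n + c) l) : copair l (compose u injl) (compose u injr) = u.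
  by apply/funext => i; rewrite /copair -{2}(splitK i); case: fintype.split.
have coeq l (u : arrow L n l) (v : arrow L c l) : compose u a = compose v h ->
    coequalizes (compose injl a) (compose injr h) (copair l u v).
  by rewrite /coequalizes !compose_assoc copairl copairr.
move=> /coeq/coequalizer_exists[m [q [sq fac epiq]]].
exists m, (compose q injl), (compose q injr); split.
  by rewrite -!compose_assoc.
move=> l u v /coeq/fac[w uvw]; exists w; split.
  by rewrite !compose_assoc -uvw copairl copairr.
move=> w' [e1 e2]; apply: epiq; rewrite -uvw -(copairE _ (compose w' q)).
by rewrite -!compose_assoc e1 e2.
Qed.

Lemma mgu_exists (L : language) (n : nat) (A : At L n) (C : clause L) (k : nat)
    (s : arrow L n k) (t : arrow L (cvars C) k) : unifier A s t ->
  exists (m : nat) (s' : arrow L n m) (t' : arrow L (cvars C) m)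
    (u : arrow L m k), [/\ mgu A s' t', s = compose u s' & t = compose u t'].
Proof.
rewrite /unifier /mgu; case: A => p a; case: (chead C) => p' h.
case=> pp'; subst p' => e0; have e := existT_inj e0.
have [m [s' [t' po]]] := pushout_exists (e : compose s a = compose t h).
have [u [[<- <-] _]] := po.2 _ _ _ e.
by exists m, s', t', u; split=> //; exists p, a, h.
Qed.

Lemma mgu_unifier (L : language) (n : nat) (A : At L n) (C : clause L) (m : nat)
    (s : arrow L n m) (t : arrow L (cvars C) m) : mgu A s t -> unifier A s t.
Proof.
rewrite /unifier => -[p [a [h [-> -> [e _]]]]]; congr Atom; exact: e.
Qed.

(** * Provability by term matching *)

(* The height bound k yields the finiteness of the subtrees extracted from a
   derivation. *)
Fixpoint derivable (L : language) (P : set (clause L)) (m k : nat)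
    (A : At L m) : Prop :=
  if k is k'.+1 then
    exists (C : clause L) (t : arrow L (cvars C) m),
      [/\ P C, A = asubst t (chead C) &
          forall j, derivable P k' (asubst t (cbody C j))]
  else False.

Definition provable (L : language) (P : set (clause L)) (m : nat)
    (A : At L m) : Prop := exists k, derivable P k A.

Lemma derivable_mono (L : language) (P : set (clause L)) (m k k' : nat)
    (A : At L m) : k <= k' -> derivable P k A -> derivable P k' A.
Proof.
elim: k k' A => // k IH [//|k'] A kk' [C [t [PC -> tb]]].
by exists C, t; split=> // j; exact: IH (tb j).
Qed.

Lemma provable_clause (L : language) (P : set (clause L)) (m : nat)
    (C : clause L) (t : arrow L (cvars C) m) : P C ->
  (forall j, provable P (asubst t (cbody C j))) ->
  provable P (asubst t (chead C)).
Proof.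
move=> PC /choice[k Hk]; exists (\max_j k j).+1, C, t; split=> // j.
by apply: derivable_mono (Hk j); exact: leq_bigmax.
Qed.

Lemma derivable_subst (L : language) (P : set (clause L)) (m m' k : nat)
    (A : At L m) (s : arrow L m m') :
  derivable P k A -> derivable P k (asubst s A).
Proof.
elim: k A => // k IH A [C [t [PC -> tb]]].
exists C, (compose s t); rewrite asubst_compose; split=> // j.
by rewrite asubst_compose; exact: IH (tb j).
Qed.

Lemma provable_subst (L : language) (P : set (clause L)) (m m' : nat)
    (A : At L m) (s : arrow L m m') : provable P A -> provable P (asubst s A).
Proof. by move=> [k /(derivable_subst s)]; exists k. Qed.

(** * SLD-resolution *)

(** Read backwards from the empty goal: an atom of [G] is either the selected one, proved by its
    clause, or has its instance in the next goal. *)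
Lemma sld_sound (L : language) (P : set (clause L)) (n m : nat)
    (G : set (At L n)) (t : arrow L n m) : sld_refutation P G t ->
  forall A, G A -> provable P (asubst t A).
Proof.
elim=> // {}n {}m k {}G s G' {}t [A [C [tc [GA PC /mgu_unifier sA ->]]]] _ IH B GB.
rewrite asubst_compose; have [->|BA] := pselect (B = A).
  rewrite sA -asubst_compose; apply: provable_clause PC _ => j.
  by rewrite asubst_compose; apply: IH; left; exists j.
by apply: IH; right; exists B.
Qed.

(** The alias [{classic _}] gives atoms the decidable equality that membership and [subseq]
    require. *)
Definition atom_seq (L : language) (n : nat) : Type := seq {classic At L n}.

Definition seq_subst (L : language) (n m : nat) (s : arrow L n m) :
    atom_seq L n -> atom_seq L m :=
  @map {classic At L n} {classic At L m} (asubst s).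

Definition body_seq (L : language) (C : clause L) (m : nat)
    (t : arrow L (cvars C) m) : atom_seq L m :=
  @map 'I_(csize C) {classic At L m} (fun j => asubst t (cbody C j))
    (enum 'I_(csize C)).

Lemma seq_subst_compose (L : language) (n m k : nat) (s : arrow L m k)
    (t : arrow L n m) (l : atom_seq L n) :
  seq_subst s (seq_subst t l) = seq_subst (compose s t) l.
Proof.
by rewrite /seq_subst -map_comp; apply: eq_map => B; rewrite /= asubst_compose.
Qed.

Lemma seq_subst_body (L : language) (C : clause L) (m k : nat) (s : arrow L m k)
    (t : arrow L (cvars C) m) : seq_subst s (body_seq t) = body_seq (compose s t).
Proof.
rewrite /seq_subst /body_seq -map_comp.
by apply: eq_map => j; rewrite /= asubst_compose.
Qed.

Definition seq_goal (L : language) (n : nat) (g : atom_seq L n) : set (At L n) :=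
  [set B : {classic At L n} | B \in g].

(* A subsequence and not all of l: goals being sets, resolving an atom also
   removes its other copies. *)
Definition solvable (L : language) (P : set (clause L)) (m : nat)
    (l : atom_seq L m) : Prop :=
  forall (n : nat) (g : atom_seq L n) (s : arrow L n m),
    subseq (seq_subst s g) l ->
  exists (k : nat) (t : arrow L n k) (u : arrow L k m),
    sld_refutation P (seq_goal g) t /\ s = compose u t.

Lemma solvable_nil (L : language) (P : set (clause L)) (m : nat) :
  solvable P ([::] : atom_seq L m).
Proof.
move=> n [|//] s _; exists n, (@id_arrow L n), s; split=> //.
have -> : seq_goal ([::] : atom_seq L n) = set0 by rewrite -subset0.
exact: sld_empty.
Qed.

Lemma solvable_cat (L : language) (P : set (clause L)) (m : nat)
    (b l : atom_seq L m) :
  (forall B, B \in b -> forall l, solvable P l -> solvable P (B :: l)) ->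
  solvable P l -> solvable P (b ++ l).
Proof.
elim: b => //= B b IH Hb sl; apply: (Hb); first exact: mem_head.
by apply: IH => // C Cb; apply: Hb; rewrite in_cons Cb orbT.
Qed.

(** Filtering discards every copy of [A], as the set difference in [sld_step] does. *)
Lemma sld_step_seq (L : language) (P : set (clause L)) (n m : nat)
    (A : {classic At L n}) (g : atom_seq L n) (C : clause L)
    (s : arrow L n m) (t : arrow L (cvars C) m) : P C -> mgu A s t ->
  sld_step P (seq_goal (A :: g)) s
    (seq_goal (body_seq t ++ seq_subst s (seq.filter (predC1 A) g))).
Proof.
move=> PC st; exists A, C, t; split=> //; first exact: mem_head.
apply/seteqP; split=> B; rewrite /seq_goal /= mem_cat.
  move=> /orP[/(mapP (T1 := 'I_(csize C)))[j _ ->]|]; first by left; exists j.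
  move=> /(mapP (T1 := {classic At L n}))[D].
  rewrite mem_filter => /andP[/eqP DA Dg] ->; right; exists D => //.
  by split=> //; rewrite /= in_cons Dg orbT.
move=> [[j ->]|[D [Dg DA] <-]]; apply/orP; [left|right].
  by apply/(mapP (T1 := 'I_(csize C))); exists j; rewrite ?mem_enum.
apply/(mapP (T1 := {classic At L n})); exists D => //; rewrite mem_filter.
by move: Dg; rewrite /= in_cons => /orP[/eqP//|->]; rewrite andbT; apply/eqP.
Qed.

(** Lifting: if the first goal atom instantiates to [A], it is resolved by a most general unifier
    through which the matcher factors; by induction on the height, the body atoms may be put in
    front of [l]. *)
Lemma solvable_cons (L : language) (P : set (clause L)) (m k : nat)
    (A : {classic At L m}) : derivable P k A ->
  forall l : atom_seq L m, solvable P l -> solvable P (A :: l).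
Proof.
elim: k A => // k IH _ [C [t [PC -> tb]]] l sl n [|A g] s.
  by move=> _; apply: sl; exact: sub0seq.
(* If the first goal atom does not instantiate to the head of the list, the whole instance is
   already a subsequence of [l]. *)
rewrite /=; case: eqP => [sA sg|_]; last exact: (sl _ (A :: g)).
have [m' [s' [t' [u [st su tu]]]]] := mgu_exists (sA : unifier A s t).
have [B||l' [r [u' [ref uu']]]] := @solvable_cat _ P _ (body_seq t) l _ sl _
    (body_seq t' ++ seq_subst s' (seq.filter (predC1 A) g)) u.
- by move=> /(mapP (T1 := 'I_(csize C)))[j _ ->]; exact: IH (tb j).
- rewrite [seq_subst _ _]map_cat; apply: cat_subseq.
    by rewrite [map _ _]seq_subst_body -tu subseq_refl.
  apply: subseq_trans sg; rewrite [map _ _]seq_subst_compose -su.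
  exact: map_subseq (filter_subseq _ _).
- exists l', (compose r s'), u'; split.
    by apply: sld_next ref; exact: sld_step_seq.
  by rewrite compose_assoc -uu'.
Qed.

Lemma correct_answer_provable (L : language) (P : set (clause L)) (n m : nat)
    (A : At L n) (t : arrow L n m) :
  correct_answer P A t <-> provable P (asubst t A).
Proof.
split=> [[k [r [s [/sld_sound rA ->]]]]|[k /solvable_cons tA]].
  by rewrite asubst_compose; apply: provable_subst; exact: rA.
have [|l [r [u [ref tu]]]] := tA _ (@solvable_nil _ P _) _ ([:: A] : atom_seq L n) t.
  exact: subseq_refl.
exists l, r, u; split=> //.
rewrite (_ : [set A] = seq_goal ([:: A] : atom_seq L n)) //.
apply/seteqP; split=> B; rewrite /seq_goal /= mem_seq1; first by move=> ->.
by move=> /eqP.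
Qed.

(** * And-or trees *)

Lemma finite_set_bounded (T : Type) (X : set T) (f : T -> nat) :
  finite_set X -> exists N, forall x, X x -> f x <= N.
Proof.
move=> /(finite_image f)/finite_seqP[s Xs]; exists (\max_(i <- s) i) => x Xx.
apply: (@leq_bigmax_seq _ s xpredT id) => //.
by have : (f @` X) (f x) by [exists x]; rewrite Xs.
Qed.

Lemma body_subst_finite (L : language) (C : clause L) (m : nat)
    (t : arrow L (cvars C) m) : finite_set (body_subst t).
Proof.
rewrite (_ : body_subst t = range (fun j => asubst t (cbody C j))).
  exact/finite_image/finite_finset.
by apply/seteqP; split=> [B [j ->]|B [j _ <-]]; exists j.
Qed.

(** Induction from the leaves: finiteness bounds the depth by some [N], and the distance to [N]
    shrinks towards the children. *)
Lemma refutation_subtree_ind (X : rule) (a0 : alabel X) (S : node_set a0)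
    (Q : and_node a0 -> Prop) : refutation_subtree S ->
  (forall t, ors S t -> (forall s, and_child t s -> Q s) -> Q (or_parent t)) ->
  forall s, ands S s -> Q s.
Proof.
move=> [[_ _ down] [finS _] branchS] step.
have [N bound] := finite_set_bounded (fun s => path_depth (and_path s)) finS.
suff H d s : N < path_depth (and_path s) + d -> ands S s -> Q s.
  by move=> s; apply: (H N.+1); rewrite addnS ltnS leq_addl.
elim: d s => [|d IH] s.
  by rewrite addn0 ltnNge => /negP Nd /bound.
move=> Nd Ss; have [t [ts St]] := branchS _ Ss; rewrite -ts; apply: step => // s' ts'.
apply: IH; last exact: down ts'.
move: ts' => [b [hb ->]] /=; rewrite ts; apply: leq_trans Nd _.
by rewrite addnS !addSn ltnW.
Qed.

(* [k] bounds the remaining height and [lab i] is forced on all the or-nodes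
   of depth 2i+1, so that the subtree extracted below is synched. *)
Fixpoint wins (X : rule) (lab : nat -> olabel X) (k i : nat) (a : alabel X) :
    Prop :=
  if k is k'.+1 then
    exists c : branch a, [/\ blabel c = lab i, finite_set (succs c) &
      forall b, succs c b -> wins lab k' i.+1 b]
  else False.

(** Extracts a branch as data; by proof irrelevance it does not depend on the proof of [wins], which
    makes [chosen] single-valued. *)
Lemma wins_branch (X : rule) (lab : nat -> olabel X) (k i : nat) (a : alabel X) :
  wins lab k i a ->
  {c : branch a | [/\ blabel c = lab i, finite_set (succs c) &
      forall b, succs c b -> wins lab k.-1 i.+1 b]}.
Proof. by case: k => // k /cid. Qed.

(* The choice depends on the depth and not only on the label: in a saturated
   tree the root may have to be resolved with theta, and a later occurrence of
   the same atom with the identity. *)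
Definition chosen (X : rule) (lab : nat -> olabel X) (N : nat) (a0 a : alabel X)
    (p : branch_path a0 a) : set (branch a) :=
  [set c | exists h : wins lab (N - (path_depth p)./2) (path_depth p)./2 a,
     c = sval (wins_branch h)].

Fixpoint follows (X : rule) (lab : nat -> olabel X) (N : nat) (a0 a : alabel X)
    (p : branch_path a0 a) : Prop :=
  match p with
  | Root => True
  | Extend _ q c _ _ => follows lab N q /\ chosen lab N q c
  end.

Definition strategy_subtree (X : rule) (lab : nat -> olabel X) (N : nat)
    (a0 : alabel X) : node_set a0 :=
  NodeSet [set s | follows lab N (and_path s)]
          [set t | follows lab N (and_path (or_parent t)) /\
                   chosen lab N (and_path (or_parent t)) (or_branch t)].

Lemma chosen_uniq (X : rule) (lab : nat -> olabel X) (N : nat) (a0 a : alabel X)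
    (p : branch_path a0 a) (c c' : branch a) :
  chosen lab N p c -> chosen lab N p c' -> c = c'.
Proof. by move=> [h ->] [h' ->]; rewrite (Prop_irrelevance h h'). Qed.

Lemma chosen_finite (X : rule) (lab : nat -> olabel X) (N : nat) (a0 a : alabel X)
    (p : branch_path a0 a) : finite_set (chosen lab N p).
Proof.
have [[c pc]|none] := pselect (exists c, chosen lab N p c).
  by apply: (sub_finite_set _ (finite_set1 c)) => c' pc'; exact: chosen_uniq pc' pc.
by apply: (sub_finite_set _ (finite_set0 _)) => c pc; case: none; exists c.
Qed.

Lemma follows_wins (X : rule) (lab : nat -> olabel X) (N : nat) (a0 a : alabel X)
    (p : branch_path a0 a) : wins lab N 0 a0 -> follows lab N p ->
  wins lab (N - (path_depth p)./2) (path_depth p)./2 a.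
Proof.
move=> w0; elim: p => [_|a' q _ c b hb [_ [h e]]] /=; first by rewrite subn0.
by case: (svalP (wins_branch h)) => _ _; rewrite subnS; apply; rewrite -e.
Qed.

Lemma follows_chosen (X : rule) (lab : nat -> olabel X) (N : nat)
    (a0 a : alabel X) (p : branch_path a0 a) :
  wins lab N 0 a0 -> follows lab N p -> exists c, chosen lab N p c.
Proof. by move=> w0 /(follows_wins w0) h; exists (sval (wins_branch h)), h. Qed.

(** Each level is finite, since a node has one chosen branch with finitely many successors, and
    there are at most [N] levels. *)
Lemma follows_finite (X : rule) (lab : nat -> olabel X) (N : nat)
    (a0 : alabel X) : wins lab N 0 a0 ->
  finite_set [set s : and_node a0 | follows lab N (and_path s)].
Proof.
move=> w0.
pose level i := [set s : and_node a0 |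
  follows lab N (and_path s) /\ (path_depth (and_path s))./2 = i].
have finite_level i : finite_set (level i).
  elim: i => [|i IH].
    apply: (sub_finite_set _ (finite_set1 (root_node a0))) => -[a p] [_] /=.
    by case: p.
  (* Outside [succs c] the root serves as a dummy value. *)
  pose child (s : and_node a0) (c : branch (and_label s)) b :=
    if pselect (succs c b) is left hb then AndNode (Extend (and_path s) hb)
    else root_node a0.
  pose next := \bigcup_(s in level i) \bigcup_(c in chosen lab N (and_path s))
    (child s c @` succs c).
  apply: (@sub_finite_set _ _ next) => [[a p] []|].
    case: p => //= a' q c b hb [fq qc] [di].
    exists (AndNode q) => //; exists c => //; exists b => //=.
    by rewrite /child; case: pselect => // hb'; rewrite (Prop_irrelevance hb hb').
  apply: bigcup_finite => // s _; apply: bigcup_finite; first exact: chosen_finite.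
  move=> c [h ->]; apply: finite_image.
  by case: (svalP (wins_branch h)).
apply: (@sub_finite_set _ _ (\bigcup_(i in `I_N) level i)).
  move=> s fs; exists (path_depth (and_path s))./2 => //=.
  (* At remaining height 0 [wins] is false, so only levels below [N] are inhabited. *)
  by have := follows_wins w0 fs; rewrite -subn_gt0; case: (N - _).
by apply: bigcup_finite => //; exact: finite_II.
Qed.

Lemma strategy_refutation (X : rule) (lab : nat -> olabel X) (N : nat)
    (a0 : alabel X) : wins lab N 0 a0 ->
  refutation_subtree (strategy_subtree lab N a0).
Proof.
move=> w0; have finS := follows_finite w0.
have branchS s : follows lab N (and_path s) ->
    exists t, or_parent t = s /\ ors (strategy_subtree lab N a0) t.
  by move=> fs; have [c sc] := follows_chosen w0 fs; exists (OrNode c).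
split=> //; first split.
- split=> // [t [] //|t s [b [hb ->]]] //.
- move=> s fs; have [t [ts St]] := branchS s fs; exists t; split=> // t' [].
  move: ts St; case: t => s1 c /= e1 [_ sc]; case: t' => s2 c' /= e2 [_ sc'].
  by subst s1 s2; rewrite (chosen_uniq sc sc').
- by move=> t s [ft tc] [b [hb ->]].
- split=> //.
  apply: (@sub_finite_set _ _ (\bigcup_(s in [set s | follows lab N (and_path s)])
      (@OrNode X a0 s @` chosen lab N (and_path s)))).
    by move=> [s c] [fs sc]; exists s => //; exists c.
  apply: bigcup_finite => // s _; apply: finite_image; exact: chosen_finite.
Qed.

Lemma strategy_label (X : rule) (lab : nat -> olabel X) (N : nat)
    (a0 : alabel X) (t : or_node a0) : ors (strategy_subtree lab N a0) t ->
  or_label t = lab (path_depth (and_path (or_parent t)))./2.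
Proof.
move=> [_ [h e]]; rewrite /or_label e.
by case: (svalP (wins_branch h)).
Qed.

(** * Coinductive trees *)

Lemma derivable_coinductive_wins (L : language) (P : set (clause L))
    (m k i : nat) (A : alabel (coinductive P m)) :
  derivable P k A -> wins (X := coinductive P m) (fun=> tt) k i A.
Proof.
elim: k i A => // k IH i A [C [t [PC AE tb]]].
have mt : unifier A (@id_arrow L m) t by rewrite /unifier asubst_var.
exists (CoindBranch PC mt : @branch (coinductive P m) A); split=> //.
  exact: body_subst_finite.
by move=> _ [j ->]; exact: IH (tb j).
Qed.

Lemma coinductive_refutation_provable (L : language) (P : set (clause L)) (m : nat)
    (B : At L m) :
  (exists S : node_set (coinductive_root P B), refutation_subtree S) <->
  provable P B.
Proof.
split=> [[S refS]|[k /(derivable_coinductive_wins 0)/strategy_refutation refS]];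
  last by eexists; exact: refS.
have Sroot : ands S (root_node (coinductive_root P B)) by case: refS => [[[]]].
pose Q (s : and_node (coinductive_root P B)) := provable P (and_label s : At L m).
apply: (refutation_subtree_ind (Q := Q) refS _ Sroot) => -[s c] _ IH.
have := cb_matcher c; rewrite /unifier asubst_var /Q /= => ->.
apply: provable_clause (cb_in c) _ => j.
have hb : @succs (coinductive P m) _ c (asubst (cb_cl c) (cbody (cb_clause c) j)).
  by exists j.
by apply: (IH (AndNode (Extend (and_path s) hb))); exists _, hb.
Qed.

(** * Saturated trees *)

Definition id_after (L : language) (n m : nat) (t : arrow L n m) (i : nat) :
    packed_arrow L :=
  if i is 0 then PackArrow t else PackArrow (@id_arrow L m).

(** A matcher for [asubst u A] is a unifier of [A] with goal part [u]. Keeping [u] general covers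
    both the root, where it is [t], and the later levels, where it is the identity. *)
Lemma derivable_saturated_wins (L : language) (P : set (clause L))
    (n m n' k i : nat) (t : arrow L n m) (u : arrow L n' m) (A : At L n') :
  id_after t i = PackArrow u -> derivable P k (asubst u A) ->
  wins (X := saturated P) (id_after t) k i (PackAtom A).
Proof.
elim: k i n' u A => // k IH i n' u A iu [C [r [PC uA rb]]].
exists (@SatBranch _ _ (PackAtom A) _ PC _ _ _ uA
  : @branch (saturated P) (PackAtom A)); split=> //.
  exact/finite_image/body_subst_finite.
move=> _ [_ [j ->] <-]; apply: (IH _ _ (@id_arrow L m)) => //.
by rewrite [asubst (@id_arrow L m) _]asubst_var; exact: rb.
Qed.

Lemma finite_depth_max (X : rule) (a0 : alabel X) (S : node_set a0) :
  refutation_subtree S ->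
  exists t, ors S t /\ forall t', ors S t' -> or_depth t' <= or_depth t.
Proof.
move=> [[[Sroot _ _] _ _] [_ finS] branchS].
have [t0 [_ St0]] := branchS _ Sroot.
have [N bound] := finite_set_bounded (fun t => or_depth t) finS.
pose D : pred nat := fun d => `[< exists t, ors S t /\ or_depth t = d >].
have exD : exists d, D d by exists (or_depth t0); apply/asboolP; exists t0.
have ubD d : D d -> d <= N by move=> /asboolP[t [St <-]]; exact: bound.
case: (ex_maxnP exD ubD) => d /asboolP[t [St td]] max; exists t; split=> // t' St'.
by rewrite td; apply: max; apply/asboolP; exists t'.
Qed.

Lemma saturated_answer_complete (L : language) (P : set (clause L)) (n m : nat)
    (A : At L n) (t : arrow L n m) : provable P (asubst t A) ->
  exists S : node_set (saturated_root P A),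
    [/\ refutation_subtree S, synched S & answer S t].
Proof.
move=> [k /(derivable_saturated_wins (t := t) (i := 0) erefl) w].
have [S refS labS] : exists2 S : node_set (saturated_root P A),
    refutation_subtree S & forall o, ors S o ->
      or_label o = id_after t (path_depth (and_path (or_parent o)))./2.
  by eexists; [exact: strategy_refutation w|exact: strategy_label].
exists S; split=> //.
  by move=> o o' /labS -> /labS -> [->].
have [o [So max]] := finite_depth_max refS; exists (or_depth o); split=> //.
(* Along the path to a deepest or-node, each or-node on the way supplies the label of its depth; all
   but the first are identities, so the composite remains [t]. *)
case: o So {max} => -[a p]; rewrite /or_depth /=.
elim: p => [|b q IH c b' hb] c' So.
  apply: composite_first.
  exists (@OrNode (saturated P) _ (root_node (saturated_root P A)) c').
  by split=> //; exact: labS _ So.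
rewrite -(compose_id t); apply: composite_next.
  apply: (IH c); move: So; case: refS => [[[_ up down] _ _] _ _] So.
  apply: down (up _ So); by exists b', hb.
exists (@OrNode (saturated P) _ (AndNode (Extend q hb)) c').
by split=> //; exact: labS _ So.
Qed.

(** Here [u] stands for the composite of the labels below depth [d]. The existential also records
    that all nodes of that depth share the context [m]. *)
Definition level_provable (L : language) (P : set (clause L))
    (a0 : alabel (saturated P)) (S : node_set a0) (d m k : nat)
    (u : arrow L m k) : Prop :=
  forall s, ands S s -> path_depth (and_path s) = d ->
    exists A : At L m, and_label s = PackAtom A /\ provable P (asubst u A).

(** Postcomposing the unifier with [u] makes the instance of [A] an instance of the clause head, to
    which the clause applies. *)
Lemma sat_branch_provable (L : language) (P : set (clause L))
    (a : packed_atom L) (c : sat_branch P a) (n m k : nat) (t : arrow L n m)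
    (u : arrow L m k) : PackArrow (sb_goal c) = PackArrow t ->
  (forall b, succs (r := saturated P) c b ->
     exists B : At L m, b = PackAtom B /\ provable P (asubst u B)) ->
  exists A : At L n, a = PackAtom A /\ provable P (asubst (compose u t) A).
Proof.
case: a c => n' A [C PC m' g r uni] /= cE child.
have e1 : n' = n by case: cE.
have e2 : m' = m by case: cE.
subst n' m'; have {}cE := PackArrow_inj cE; subst g.
exists A; split=> //; rewrite asubst_compose uni -asubst_compose.
apply: provable_clause PC _ => j; rewrite asubst_compose.
have [|B [/PackAtom_inj <-]] // := child (PackAtom (asubst r (cbody C j))).
by exists (asubst r (cbody C j)) => //; exists j.
Qed.

(** Synchronization makes [t] the label of every or-node at this depth, so a single [u] serves all
    their children. *)
Lemma level_step (L : language) (P : set (clause L))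
    (a0 : alabel (saturated P)) (S : node_set a0) (d n m k : nat)
    (t : arrow L n m) (u : arrow L m k) :
  refutation_subtree S -> synched S -> label_at_depth S d.+1 t ->
  level_provable S d.+2 u -> level_provable S d (compose u t).
Proof.
move=> [[_ _ down] _ branchS] sync [o [So od ot]] next s Ss sd.
have [t' [ts St']] := branchS _ Ss.
have : or_label t' = PackArrow t.
  by rewrite -ot; apply: sync => //; rewrite od /or_depth ts sd.
subst s; case: t' => -[a p] c /= in Ss St' sd *.
rewrite /or_label /= => cE.
have child b (hb : succs c b) : exists B : At L m, b = PackAtom B /\ provable P (asubst u B).
  have := next (@AndNode (saturated P) a0 b (Extend p hb)).
  apply=> /=; last by rewrite sd.
  by apply: down St' _; exists b, hb.
exact: sat_branch_provable cE child.
Qed.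

Lemma composite_root (L : language) (P : set (clause L))
    (a0 : alabel (saturated P)) (S : node_set a0) (d n m k : nat)
    (t : arrow L n m) (u : arrow L m k) :
  refutation_subtree S -> synched S -> composite S d t ->
  level_provable S d.+1 u -> level_provable S 0 (compose u t).
Proof.
move=> refS sync comp; elim: comp k u => [{}n {}m {}t lab|{}d {}n {}m l {}t s _ IH lab] k u next.
  exact: level_step next.
rewrite compose_assoc; apply: IH; exact: level_step next.
Qed.

Lemma saturated_answer_sound (L : language) (P : set (clause L)) (n m : nat)
    (A : At L n) (t : arrow L n m) (S : node_set (saturated_root P A)) :
  refutation_subtree S -> synched S -> answer S t -> provable P (asubst t A).
Proof.
move=> refS sync [d [max comp]].
(* This holds vacuously: an and-node at depth [d.+1] would have an or-child deeper than [d]. *)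
have bottom : level_provable S d.+1 (@id_arrow L m).
  move=> s Ss sd; have [_ _ branchS] := refS.
  have [o [os So]] := branchS _ Ss.
  by have := max o So; rewrite /or_depth os sd ltnNge leqnSn.
have := composite_root refS sync comp bottom; rewrite compose_id.
have Sroot : ands S (root_node (saturated_root P A)) by case: refS => [[[]]].
by move=> /(_ _ Sroot erefl)[B [/PackAtom_inj <-]].
Qed.

Theorem theorem6p2 (L : language) (P : set (clause L)) (finP : finite_set P)
    (n : nat) (A : At L n) (theta : 'I_n -> term L nat) :
  let saturated_refutation :=
    exists (m : nat) (t : arrow L n m), raw_arrow t = theta /\
      exists S : node_set (saturated_root P A),
        [/\ refutation_subtree S, synched S & answer S t] in
  let coinductive_refutation :=
    exists (m : nat) (B : At L m), raw_atom B = asubst theta A /\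
      exists S : node_set (coinductive_root P B), refutation_subtree S in
  let sld_correct_answer :=
    exists (m : nat) (t : arrow L n m), raw_arrow t = theta /\
      correct_answer P A t in
  (saturated_refutation <-> coinductive_refutation) /\
  (coinductive_refutation <-> sld_correct_answer).
Proof.
move=> sat coind sld.
(* Each of the three conditions is shown equivalent to this one. *)
pose prov := exists (m : nat) (t : arrow L n m),
  raw_arrow t = theta /\ provable P (asubst t A).
have coindP : coind <-> prov.
  split=> [[m [B [BA /coinductive_refutation_provable pB]]]|[m [t [tE tA]]]].
    have [k [t [w [tE wB]]]] := raw_asubst_bound BA.
    by exists k, t; split=> //; rewrite -wB; exact: provable_subst.
  exists m, (asubst t A); rewrite raw_asubst tE; split=> //.
  exact/coinductive_refutation_provable.
have satP : sat <-> prov.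
  split=> -[m [t [tE]]]; last first.
    by move=> /saturated_answer_complete H; exists m, t.
  move=> [S [refS sync ans]]; exists m, t; split=> //.
    exact: saturated_answer_sound refS sync ans.
have sldP : sld <-> prov.
  by split=> -[m [t [tE /correct_answer_provable H]]]; exists m, t.
by rewrite coindP satP sldP.
Qed.
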